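(* Let $\gamma, M \in (0,\infty)$ and $\delta \ge 0$. Let $$\mathbf v \in \mathcal R^M := \{ \mathbf v : \|\hat{\boldsymbol\alpha}(\mathbf v)\| < M \},$$ and let $\mathbf v^\delta \in \mathbb R^n$ satisfy $\|\mathbf v^\delta - \mathbf v\| \le \delta$. Then $$\|\hat{\mathbf v}(\hat{\boldsymbol\alpha}_\gamma(\mathbf v^\delta)) - \mathbf v\| \le \delta + M\gamma .$$
   Context: Setting. Let $V \subseteq \mathbb R^d$ be the velocity domain and write $\langle g\rangle := \int_V g(v)\,dv$. Let $\mathbf m(v) = (m_0(v),\dots,m_{n-1}(v))$ be a vector of real-valued (linearly independent) basis functions on $V$. Let $\eta : D \to \mathbb R$, $D\subseteq\mathbb R$, be a strictly convex, twice continuously differentiable kinetic entropy density, and let $\eta_*$ be its Legendre dual, $\eta_*(y) = \sup_{z\in D}\{yz-\eta(z)\}$. Let $\mathbb F(V) = \{g \in L^1(V) : \mathrm{Range}(g)\subseteq D\}$. $\|\cdot\|$ is the Euclidean norm on $\mathbb R^n$. For $\boldsymbol\alpha\in\mathbb R^n$ put $G_{\boldsymbol\alpha} := \eta_*'(\boldsymbol\alpha\cdot\mathbf m)$ and $\hat{\mathbf v}(\boldsymbol\alpha) := \langle \mathbf m\, G_{\boldsymbol\alpha}\rangle$ (whenever these are defined and finite). Original problem: minimize $\langle\eta(g)\rangle$ over $g\in\mathbb F(V)$ subject to $\langle \mathbf m g\rangle = \mathbf v$. Its dual solution is $$\hat{\boldsymbol\alpha}(\mathbf v) := \operatorname{argmax}_{\boldsymbol\alpha\in\mathbb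 R^n}\{\boldsymbol\alpha\cdot\mathbf v - \langle \eta_*(\boldsymbol\alpha\cdot\mathbf m)\rangle\}.$$ Regularized problem: minimize $\langle\eta(g)\rangle + \frac{1}{2\gamma}\|\langle\mathbf m g\rangle - \mathbf w\|^2$ over $g\in\mathbb F(V)$, for $\mathbf w\in\mathbb R^n$. Its dual solution is $$\hat{\boldsymbol\alpha}_\gamma(\mathbf w) := \operatorname{argmax}_{\boldsymbol\alpha\in\mathbb R^n}\{\boldsymbol\alpha\cdot\mathbf w - \langle \eta_*(\boldsymbol\alpha\cdot\mathbf m)\rangle - \tfrac{\gamma}{2}\|\boldsymbol\alpha\|^2\}.$$ Standing assumptions. (A1) For $\mathbf v\in\mathcal R^M$ the original problem has a solution, namely $G_{\hat{\boldsymbol\alpha}(\mathbf v)}$, so that $\hat{\mathbf v}(\hat{\boldsymbol\alpha}(\mathbf v)) = \mathbf v$ (i.e. $\hat{\mathbf v}$ is the inverse of $\hat{\boldsymbol\alpha}$). (A2) The regularized problem with datum $\mathbf w=\mathbf v^\delta$ has a minimizer, namely $G_{\hat{\boldsymbol\alpha}_\gamma(\mathbf w)}$, so that the first-order optimality condition $\mathbf w = \hat{\mathbf v}(\hat{\boldsymbol\alpha}_\gamma(\mathbf w)) + \gamma\,\hat{\boldsymbol\alpha}_\gamma(\mathbf w)$ holds. *)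

(* Defs.v *)
From HB Require Import structures.
From mathcomp Require Import all_boot all_order all_algebra.
From mathcomp Require Import all_classical all_reals all_analysis.
Import Order.TTheory GRing.Theory Num.Theory.
Import numFieldNormedType.Exports.

Set Implicit Arguments.
Unset Strict Implicit.
Unset Printing Implicit Defensive.

Local Open Scope classical_set_scope.
Local Open Scope ring_scope.

(* Points of R^d are d-tuples, measured with the product sigma-algebra, which
   is the Borel sigma-algebra of R^d. *)
Notation Rspace R d := (d.-tuple (measurableTypeR R)).

Section lebesgue_step.
Context {R : realType} (d : nat).
Variable mu : {sigma_finite_measure set (Rspace R d) -> \bar R}.

Let glue (p : measurableTypeR R * Rspace R d) : Rspace R d.+1 :=
  [tuple of p.1 :: p.2].

Let measurable_glue : measurable_fun [set: measurableTypeR R * Rspace R d] glue.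
Proof. by apply: measurable_cons. Qed.

Definition lebesgue_step : set (Rspace R d.+1) -> \bar R :=
  pushforward (lebesgue_measure \x mu)%E glue.

Let step0 : lebesgue_step set0 = 0%E.
Proof. by rewrite /lebesgue_step /pushforward preimage_set0 measure0. Qed.

Let step_ge0 A : (0 <= lebesgue_step A)%E.
Proof. exact: measure_ge0. Qed.

Let step_sigma_additive : semi_sigma_additive lebesgue_step.
Proof.
move=> F mF tF mUF; rewrite /lebesgue_step /pushforward preimage_bigcup.
apply: measure_semi_sigma_additive.
- by move=> n; rewrite -[X in measurable X]setTI; exact: measurable_glue.
- apply/trivIsetP => i j _ _ ij; rewrite -preimage_setI.
  by move/trivIsetP : tF => /(_ _ _ _ _ ij) ->//; rewrite preimage_set0.
- rewrite -preimage_bigcup -[X in measurable X]setTI.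
  exact: measurable_glue.
Qed.

HB.instance Definition _ := isMeasure.Build _ _ _ lebesgue_step
  step0 step_ge0 step_sigma_additive.

Let step_sigma_finite : sigma_finite setT lebesgue_step.
Proof.
have /sigma_finiteP[F [TF ndF Foo]] := sigma_finiteT (@lebesgue_measure R).
have /sigma_finiteP[G [TG ndG Goo]] := sigma_finiteT mu.
pose unglue (x : Rspace R d.+1) : measurableTypeR R * Rspace R d :=
  (thead x, [tuple of behead x]).
have unglueK p : unglue (glue p) = p.
  case: p => a t; rewrite /unglue /glue /thead /tnth /=; congr pair.
  exact/val_inj.
have munglue : measurable_fun [set: Rspace R d.+1] unglue.
  apply/measurable_fun_pairP; split.
    exact: measurable_tnth.
  exact: measurable_behead.
exists (fun k => unglue @^-1` (F k `*` G k)).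
  apply/seteqP; split=> // x _.
  have [i _ Fi] : (\bigcup_i F i) (unglue x).1 by rewrite -TF.
  have [j _ Gj] : (\bigcup_i G i) (unglue x).2 by rewrite -TG.
  exists (maxn i j) => //; split.
    by move: Fi; exact/subsetPset/ndF/leq_maxl.
  by move: Gj; exact/subsetPset/ndG/leq_maxr.
move=> k; have [mFk Fkoo] := Foo k; have [mGk Gkoo] := Goo k; split.
  by rewrite -[X in measurable X]setTI; apply: munglue => //; exact: measurableX.
rewrite /lebesgue_step /pushforward -comp_preimage.
rewrite (_ : unglue \o glue = id) ?preimage_id; last exact/funext.
by rewrite product_measure1E// lte_mul_pinfty// ge0_fin_numE.
Qed.

HB.instance Definition _ := Measure_isSigmaFinite.Build _ _ _ lebesgue_step
  step_sigma_finite.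

End lebesgue_step.

(* The d-dimensional Lebesgue measure, as a d-fold product. *)
Fixpoint lebesgue {R : realType} (d : nat) :
    {sigma_finite_measure set (Rspace R d) -> \bar R} :=
  match d with
  | 0 => \d_([tuple] : Rspace R 0)
  | d'.+1 => lebesgue_step (lebesgue d')
  end.

Lemma lebesgue_box {R : realType} (d : nat) (A : 'I_d -> set (measurableTypeR R)) :
  (forall i, measurable (A i)) ->
  lebesgue d [set x | forall i, A i (tnth x i)] =
  (\prod_(i < d) lebesgue_measure (A i))%E.
Proof.
elim: d A => [|d IH] A mA /=.
  by rewrite big_ord0 diracE mem_set//= => -[].
rewrite big_ord_recl /lebesgue_step /pushforward /= -IH//.
rewrite -product_measure1E//; last first.
  rewrite [X in measurable X](_ : _ =
    \bigcap_(i in [set: 'I_d]) ((@tnth d (measurableTypeR R) ^~ i) @^-1` A (lift ord0 i))).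
    apply: fin_bigcap_measurable => // i _.
    by rewrite -[X in measurable X]setTI; exact: measurable_tnth.
  by apply/seteqP; split=> x /= h i; [move=> _|]; exact: h.
congr (_ _); apply/seteqP; split=> [[a t] h|[a t] [/= h0 h] i].
  by split=> [|i] /=; [exact: (h ord0)|have := h (lift ord0 i); rewrite tnthS].
by case: (unliftP ord0 i) => [j ->|->] //=; rewrite tnthS; exact: h.
Qed.

(* The norm `|x| of 'rV[R]_n is the sup norm, hence the explicit Euclidean one. *)
Definition dotp {R : realType} {n : nat} (a b : 'rV[R]_n) : R :=
  \sum_(i < n) a ord0 i * b ord0 i.

Definition enorm {R : realType} {n : nat} (a : 'rV[R]_n) : R :=
  Num.sqrt (dotp a a).

(* Optimal points of an extended-real objective F over A; the optimal value has
   to be finite. *)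
Definition argmin {R : realType} {T : Type} (A : set T) (F : T -> \bar R) : set T :=
  [set x | [/\ A x, F x \is a fin_num & forall y, A y -> (F x <= F y)%E]].

Definition argmax {R : realType} {T : Type} (A : set T) (F : T -> \bar R) : set T :=
  [set x | [/\ A x, F x \is a fin_num & forall y, A y -> (F y <= F x)%E]].

Section entropy_density.
Context {R : realType}.
Implicit Types (D : set R) (eta : R -> R).

Definition strictly_convex_on D eta : Prop :=
  is_interval D /\
  forall x y t, D x -> D y -> x != y -> 0 < t < 1 ->
    eta (t * x + (1 - t) * y) < t * eta x + (1 - t) * eta y.

(* D may contain endpoints at which eta is only continuous, as for
   eta z = z * ln z - z on [0, +oo[. *)
Definition twice_cont_diff_on D eta : Prop :=
  {within D, continuous eta} /\
  forall x, D° x ->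
    [/\ derivable eta x 1, derivable (derive1 eta) x 1
      & {for x, continuous (derive1n 2 eta)}].

Definition entropy_density D eta : Prop :=
  [/\ D !=set0, strictly_convex_on D eta & twice_cont_diff_on D eta].

Definition legendre_dual D eta (y : R) : \bar R :=
  ereal_sup [set (y * z - eta z)%:E | z in D].

Definition dlegendre_dual D eta : R -> R := derive1 (fine \o legendre_dual D eta).

(* `fine` sends +oo to 0, so derivability of fine \o legendre_dual alone would
   also hold at points where the dual is infinite. *)
Definition legendre_dual_derivable D eta (y : R) : Prop :=
  (\forall x \near y, legendre_dual D eta x \is a fin_num) /\
  derivable (fine \o legendre_dual D eta) y 1.

End entropy_density.

Section moment_problem.
Context {R : realType} {d n : nat}.
Variables (V : set (Rspace R d)) (m : Rspace R d -> 'rV[R]_n).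
Variables (D : set R) (eta : R -> R).
Implicit Types (g : Rspace R d -> R) (a w : 'rV[R]_n).

Local Notation mu := (@lebesgue R d).

(* At least one of the two parts has a finite integral. Outside this case the
   library's integral takes the value -oo by convention. *)
Definition integral_defined (f : Rspace R d -> \bar R) : Prop :=
  (\int[mu]_(x in V) f^\+ x < +oo)%E \/ (\int[mu]_(x in V) f^\- x < +oo)%E.

Definition linearly_independent_basis : Prop :=
  forall c : 'rV[R]_n, (forall x, V x -> dotp c (m x) = 0) -> c = 0.

Definition has_moments g : Prop :=
  forall i, mu.-integrable V (fun x => (m x ord0 i * g x)%:E).

Definition moments g : 'rV[R]_n :=
  \row_(i < n) \int[mu]_(x in V) (m x ord0 i * g x).

(* Elements of L^1(V) are classes modulo null sets, so the range is an
   almost everywhere notion. *)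
Definition FV : set (Rspace R d -> R) :=
  [set g | mu.-integrable V (EFin \o g) /\ {ae mu, forall x, V x -> D (g x)}].

Definition entropy g : \bar R := (\int[mu]_(x in V) (eta (g x))%:E)%E.

Definition entropy_dom : set (Rspace R d -> R) :=
  [set g | [/\ FV g, has_moments g & integral_defined (EFin \o eta \o g)]].

Definition original_minimizers w : set (Rspace R d -> R) :=
  argmin [set g | entropy_dom g /\ moments g = w] entropy.

Definition regularized_minimizers (gamma : R) w : set (Rspace R d -> R) :=
  argmin entropy_dom
    (fun g => entropy g + ((2 * gamma)^-1 * enorm (moments g - w) ^+ 2)%:E)%E.

Definition dual_dom : set 'rV[R]_n :=
  [set a | integral_defined (fun x => legendre_dual D eta (dotp a (m x)))].

Definition dual_obj w a : \bar R :=
  ((dotp a w)%:E - \int[mu]_(x in V) legendre_dual D eta (dotp a (m x)))%E.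

Definition dual_maximizers w : set 'rV[R]_n := argmax dual_dom (dual_obj w).

Definition regularized_dual_maximizers (gamma : R) w : set 'rV[R]_n :=
  argmax dual_dom (fun a => dual_obj w a - (gamma / 2 * enorm a ^+ 2)%:E)%E.

(* A maximizer whenever there is one, 0 otherwise; likewise for alpha_reg. *)
Definition alpha_hat w : 'rV[R]_n := xget 0 (dual_maximizers w).

Definition alpha_reg (gamma : R) w : 'rV[R]_n :=
  xget 0 (regularized_dual_maximizers gamma w).

Definition ansatz a : Rspace R d -> R := fun x => dlegendre_dual D eta (dotp a (m x)).

Definition ansatz_defined a : Prop :=
  {ae mu, forall x, V x -> legendre_dual_derivable D eta (dotp a (m x))}.

Definition v_hat a : 'rV[R]_n := moments (ansatz a).

Definition RM (M : R) : set 'rV[R]_n :=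
  [set w | dual_maximizers w !=set0 /\ enorm (alpha_hat w) < M].

End moment_problem.

(* Main.v *)
Require Import Defs.
From mathcomp Require Import all_boot all_order all_algebra.
From mathcomp Require Import all_classical all_reals all_analysis.
From mathcomp Require Import lra.
Import Order.TTheory GRing.Theory Num.Theory.
Import numFieldNormedType.Exports.

Set Implicit Arguments.
Unset Strict Implicit.
Unset Printing Implicit Defensive.

Local Open Scope classical_set_scope.
Local Open Scope ring_scope.

(** The moment map [v_hat] is formally the gradient of the convex function
    sending alpha to the integral of the Legendre dual at [dotp alpha (m x)], hence it
    is monotone: with a the multiplier of the exact datum, so that
    [v_hat a = v], and b the regularized multiplier of [vdelta],
    (v_hat b - v) . (b - a) >= 0 ([dotp_v_hat_ge0]).  Put u := v_hat b.  The
    optimality condition vdelta = u + gamma b reads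
    u - v = (vdelta - v) - gamma b, and pairing it with u - v gives
      |u - v|^2 = (u - v) . (vdelta - v) - gamma (u - v) . b
               <= (u - v) . (vdelta - v) - gamma (u - v) . a
               <= |u - v| (delta + gamma M)
    by monotonicity and the Cauchy-Schwarz inequality.

    Monotonicity is obtained without differentiating under the integral sign.
    The Legendre dual, a supremum of affine functions, is convex, so its
    derivative is monotone between any two points where it exists
    ([dlegendre_dual_monotone]); evaluated at [dotp a (m x)] and
    [dotp b (m x)], this makes the integrand of (v_hat b - v_hat a) . (b - a)
    nonnegative almost everywhere. *)

(** * The Euclidean inner product *)

Section dotp_theory.
Context {R : realType} {n : nat}.
Implicit Types (a b c : 'rV[R]_n) (k : R).

Lemma dotpC a b : dotp a b = dotp b a.
Proof. by apply: eq_bigr => i _; rewrite mulrC. Qed.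

Lemma dotpDl a b c : dotp (a + b) c = dotp a c + dotp b c.
Proof. by rewrite -big_split; apply: eq_bigr => i _; rewrite !mxE mulrDl. Qed.

Lemma dotpZl k a c : dotp (k *: a) c = k * dotp a c.
Proof. by rewrite mulr_sumr; apply: eq_bigr => i _; rewrite !mxE mulrA. Qed.

Lemma dotpBl a b c : dotp (a - b) c = dotp a c - dotp b c.
Proof. by rewrite -scaleN1r dotpDl dotpZl mulN1r. Qed.

Lemma dotp0l c : dotp 0 c = 0.
Proof. by rewrite -(scale0r 0) dotpZl mul0r. Qed.

Lemma dotp_ge0 a : 0 <= dotp a a.
Proof. by apply: sumr_ge0 => i _; rewrite -expr2 sqr_ge0. Qed.

Lemma enorm_ge0 a : 0 <= enorm a. Proof. exact: sqrtr_ge0. Qed.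

Lemma sqr_enorm a : enorm a ^+ 2 = dotp a a.
Proof. by rewrite sqr_sqrtr ?dotp_ge0. Qed.

Lemma enorm_eq0 a : enorm a = 0 -> a = 0.
Proof.
move=> a0; have : dotp a a = 0 by rewrite -sqr_enorm a0 expr0n.
move=> /psumr_eq0P aa0; apply/rowP => i; rewrite mxE.
apply/eqP; rewrite -sqrf_eq0 expr2; apply/eqP/aa0 => // j _.
by rewrite -expr2 sqr_ge0.
Qed.

Lemma CauchySchwarz_dotp a b : dotp a b <= enorm a * enorm b.
Proof.
have [a0|a0] := eqVneq (enorm a) 0.
  by rewrite a0 mul0r (enorm_eq0 a0) dotp0l.
have [b0|b0] := eqVneq (enorm b) 0.
  by rewrite b0 mulr0 (enorm_eq0 b0) dotpC dotp0l.
have ab0 : 0 < enorm a * enorm b.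
  by rewrite mulr_gt0 // lt_neqAle eq_sym enorm_ge0 ?a0 ?b0.
(* Expand 0 <= | |b| a - |a| b |^2. *)
have := dotp_ge0 (enorm b *: a - enorm a *: b).
rewrite dotpBl !dotpZl !(dotpC _ (_ - _)) !dotpBl !dotpZl (dotpC b a).
rewrite -!sqr_enorm => h; rewrite -subr_ge0 -(pmulr_rge0 _ ab0).
nra.
Qed.

End dotp_theory.

(** * Monotonicity of the derivative of the Legendre dual *)

Section legendre_dual_theory.
Context {R : realType}.
Variables (D : set R) (eta : R -> R).
Local Notation L := (legendre_dual D eta).

Lemma legendre_dual_convex (x y t : R) : 0 <= t <= 1 ->
  (L (t * y + (1 - t) * x)%R <= t%:E * L y + (1 - t)%R%:E * L x)%E.
Proof.
move=> /andP[t0 t1]; apply: ge_ereal_sup => _ [z Dz <-].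
rewrite (_ : _ - _ = t * (y * z - eta z) + (1 - t) * (x * z - eta z)); last by lra.
rewrite EFinD !EFinM; apply: leeD; apply: lee_wpmul2l; rewrite ?lee_fin ?subr_ge0 //.
  by apply: ereal_sup_ubound; exists z.
by apply: ereal_sup_ubound; exists z.
Qed.

(** By convexity the difference quotients of the dual along the segment from x
    to y stay below its increment over the whole segment, and so does their
    limit, which is the derivative at x times y - x. *)
Lemma legendre_dual_subgradient (x y : R) :
  legendre_dual_derivable D eta x -> L y \is a fin_num ->
  dlegendre_dual D eta x * (y - x) <= fine (L y) - fine (L x).
Proof.
move=> [Lfin dL] Ly; have Lx := nbhs_singleton Lfin.
set f := fine \o L; have df : differentiable f x by exact/derivable1_diffP.
have -> : dlegendre_dual D eta x * (y - x) = 'D_(y - x) f x.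
  rewrite deriveE // deriv1E //= /dlegendre_dual -/f.
  by rewrite mulrC.
have dfv : derivable f x (y - x) by exact: diff_derivable.
rewrite /derive cvg_at_rightE //; apply: limr_le.
  by apply/cvg_ex; eexists; apply: cvg_dnbhs_at_right; exact: dfv.
have segcv : t *: (y - x) + x @[t --> (0 : R)^'+] --> x.
  apply: cvg_at_right_filter.
  rewrite -[X in _ --> X]add0r -[X in _ --> X + _](scale0r (y - x)).
  by apply: cvgD; [apply: cvgZr_tmp; exact: cvg_id | exact: cvg_cst].
near=> t.
have t0 : 0 < t by near: t; exact: nbhs_right_gt.
have t1 : t <= 1 by near: t; exact: nbhs_right_ltW.
have E : t *: (y - x) + x = t * y + (1 - t) * x by rewrite /GRing.scale /=; lra.
have Ltx : L (t *: (y - x) + x) \is a fin_num.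
  by near: t; exact: (segcv _ Lfin).
have := @legendre_dual_convex x y t; rewrite (ltW t0) t1 -E => /(_ isT).
rewrite /f /= -(fineK Ltx) -(fineK Lx) -(fineK Ly) /= -!EFinM -EFinD lee_fin => h.
rewrite /GRing.scale /= mulrC ler_pdivrMr // lerBlDr; nra.
Unshelve. all: by end_near.
Qed.

Lemma dlegendre_dual_monotone (x y : R) :
  legendre_dual_derivable D eta x -> legendre_dual_derivable D eta y ->
  0 <= (y - x) * (dlegendre_dual D eta y - dlegendre_dual D eta x).
Proof.
move=> dx dy.
have hx := legendre_dual_subgradient dx (nbhs_singleton dy.1).
have hy := legendre_dual_subgradient dy (nbhs_singleton dx.1).
nra.
Qed.

End legendre_dual_theory.

(** * Monotonicity of the moment map *)

Lemma ae_Rintegral_ge0 (d : measure_display) (T : measurableType d)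
    (R : realType) (mu : {measure set T -> \bar R}) (A : set T) (f : T -> R) :
  measurable A -> mu.-integrable A (EFin \o f) ->
  {ae mu, forall x, A x -> 0 <= f x} -> 0 <= \int[mu]_(x in A) f x.
Proof.
move=> mA intf f0; rewrite /Rintegral.
(* f and |f| agree almost everywhere, hence have the same integral. *)
rewrite (_ : (\int[mu]_(x in A) _)%E = (\int[mu]_(x in A) `|(f x)%:E|)%E).
  by apply: fine_ge0; apply: integral_ge0 => x _; exact: abse_ge0.
apply: ae_eq_integral => //.
- exact: measurable_int intf.
- exact: measurable_int (integrable_abse intf).
by apply: filterS f0 => x fx0 Ax; rewrite /= ger0_norm ?fx0.
Qed.

Section moment_theory.
Context {R : realType} {d n : nat}.
Variables (V : set (Rspace R d)) (m : Rspace R d -> 'rV[R]_n).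
Hypothesis mV : measurable V.
Implicit Types (g h : Rspace R d -> R) (c : 'rV[R]_n).
Local Notation mu := (@lebesgue R d).

Lemma has_momentsB g h : has_moments V m g -> has_moments V m h ->
  has_moments V m (g \- h).
Proof.
move=> mg mh i; have := integrableB mV (mg i) (mh i).
by apply: eq_integrable => // x _; rewrite /= -EFinB -mulrBr.
Qed.

Lemma momentsB g h : has_moments V m g -> has_moments V m h ->
  moments V m (g \- h) = moments V m g - moments V m h.
Proof.
move=> mg mh; apply/rowP => i; rewrite !mxE -RintegralB //; [|exact: mg|exact: mh].
by apply: eq_Rintegral => x _; rewrite /= mulrBr.
Qed.

Let dotp_EFin c g (x : Rspace R d) :
  (dotp c (m x) * g x)%:E =
  (\sum_(i < n) (c ord0 i)%:E * (m x ord0 i * g x)%:E)%E.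
Proof.
rewrite mulr_suml -sumEFin; apply: eq_bigr => i _.
by rewrite -EFinM mulrA.
Qed.

Lemma integrable_dotp c g : has_moments V m g ->
  mu.-integrable V (fun x => (dotp c (m x) * g x)%:E).
Proof.
move=> mg; under eq_fun do rewrite dotp_EFin.
by apply: integrable_sum => // i _; exact/integrableZl/mg.
Qed.

Lemma dotp_moments c g : has_moments V m g ->
  dotp c (moments V m g) = \int[mu]_(x in V) (dotp c (m x) * g x).
Proof.
move=> mg; rewrite /Rintegral.
under eq_integral do rewrite dotp_EFin.
rewrite integral_sum //; last by move=> i; exact/integrableZl/mg.
rewrite [X in fine X](_ : _ =
  (\sum_(i < n) (c ord0 i * moments V m g ord0 i)%:E)%E).
  by rewrite sumEFin.
apply: eq_bigr => i _.
by rewrite integralZl // mxE EFinM fineK // (integrable_fin_num mV (mg i)).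
Qed.

Lemma dotp_v_hat_ge0 (D : set R) (eta : R -> R) (a b : 'rV[R]_n) :
  ansatz_defined V m D eta a -> has_moments V m (ansatz m D eta a) ->
  ansatz_defined V m D eta b -> has_moments V m (ansatz m D eta b) ->
  0 <= dotp (b - a) (v_hat V m D eta b - v_hat V m D eta a).
Proof.
move=> da ma db mb; rewrite /v_hat -momentsB // dotp_moments; last first.
  exact: has_momentsB.
apply: ae_Rintegral_ge0 => //; first exact/integrable_dotp/has_momentsB.
apply: filterS2 da db => x dax dbx Vx.
by rewrite dotpBl; apply: dlegendre_dual_monotone; [exact: dax|exact: dbx].
Qed.

End moment_theory.

(** * The error bound *)

(** A resolvent estimate: pairing w - v = (u - v) + gamma b with u - v leaves
    the term gamma b . (u - v), for which no bound on b is at hand; monotonicity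
    lets a, whose norm is controlled, replace b there. *)
Lemma monotone_regularization_bound (R : realType) (n : nat)
    (a b u v w : 'rV[R]_n) (gamma : R) :
  0 <= gamma -> 0 <= dotp (b - a) (u - v) -> w = u + gamma *: b ->
  enorm (u - v) <= enorm (w - v) + enorm a * gamma.
Proof.
move=> g0 mono wE; set r := u - v.
have [r0|r0] := eqVneq (enorm r) 0.
  by rewrite r0 addr_ge0 ?mulr_ge0 ?enorm_ge0.
have {}r0 : 0 < enorm r by rewrite lt_neqAle eq_sym r0 enorm_ge0.
have rE : r = (w - v) - gamma *: b.
  by rewrite wE addrAC addrK.
have rr : enorm r ^+ 2 = dotp (w - v) r - gamma * dotp b r.
  by rewrite -dotpZl -dotpBl -rE sqr_enorm.
have cs1 := CauchySchwarz_dotp (w - v) r.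
have cs2 := CauchySchwarz_dotp ((-1) *: a) r.
have na : enorm ((-1) *: a) = enorm a.
  by rewrite /enorm dotpZl dotpC dotpZl mulrA mulrNN !mul1r.
rewrite na dotpZl in cs2; rewrite dotpBl -/r in mono.
rewrite -(ler_pM2r r0) -expr2 rr mulrDl; apply: lerD => //.
rewrite -mulrN [leRHS](_ : _ = gamma * (enorm a * enorm r)); last by lra.
apply: ler_wpM2l => //; apply: le_trans _ cs2.
by rewrite mulN1r lerN2 -subr_ge0.
Qed.

Theorem mainTheorem1 (R : realType) (d n : nat)
    (V : set (Rspace R d)) (m : Rspace R d -> 'rV[R]_n)
    (D : set R) (eta : R -> R) (gamma M delta : R) (v vdelta : 'rV[R]_n)
    (measurable_V : measurable V)
    (measurable_m : forall i, measurable_fun V (fun x => m x ord0 i))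
    (independent_m : linearly_independent_basis V m)
    (entropy_eta : entropy_density D eta)
    (gamma_gt0 : 0 < gamma) (M_gt0 : 0 < M) (delta_ge0 : 0 <= delta)
    (original_solvable : forall u, RM V m D eta M u ->
      let a := alpha_hat V m D eta u in
      ansatz_defined V m D eta a /\
      original_minimizers V m D eta u (ansatz m D eta a))
    (regularized_solvable :
      let b := alpha_reg V m D eta gamma vdelta in
      [/\ regularized_dual_maximizers V m D eta gamma vdelta b,
          ansatz_defined V m D eta b,
          regularized_minimizers V m D eta gamma vdelta (ansatz m D eta b) &
          vdelta = v_hat V m D eta b + gamma *: b])
    (v_in_RM : RM V m D eta M v)
    (vdelta_close : enorm (vdelta - v) <= delta) :
  enorm (v_hat V m D eta (alpha_reg V m D eta gamma vdelta) - v)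
    <= delta + M * gamma.
Proof.
have [da [[[_ ma _] va] _ _]] := original_solvable v v_in_RM.
have [_ db [[_ mb _] _ _] wE] := regularized_solvable.
have mono := dotp_v_hat_ge0 measurable_V da ma db mb.
have {}va : v_hat V m D eta (alpha_hat V m D eta v) = v by exact: va.
rewrite va in mono.
apply: le_trans (monotone_regularization_bound (ltW gamma_gt0) mono wE) _.
by rewrite lerD // ler_wpM2r ?ltW // v_in_RM.2.
Qed.
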